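(* For every integer $k\ge 2$, $$F_{21\text{-}3\text{-}\cdots\text{-}k}(x,y)=1-\cfrac{x}{xy^{d_1}-\cfrac{1}{1-\cfrac{x}{xy^{d_2}-\cfrac{1}{1-\cfrac{x}{xy^{d_3}-\cfrac{1}{\ddots}}}}}},$$ where $d_i=\binom{i-1}{k-2}$ for $i\ge 1$, and $\binom ab$ is taken to be $0$ whenever $a<b$ or $b<0$.
   Context: Generalized patterns: a generalized pattern is a permutation $\tau=\tau_1\cdots\tau_k$ of $\{1,\dots,k\}$ written with dashes between some of its adjacent letters. An occurrence of $\tau$ in $\pi=\pi_1\cdots\pi_n\in S_n$ is a choice of positions $i_1<\dots<i_k$ such that $(\pi_{i_1},\dots,\pi_{i_k})$ is order-isomorphic to $(\tau_1,\dots,\tau_k)$ and $i_{j+1}=i_j+1$ whenever there is no dash between $\tau_j$ and $\tau_{j+1}$. The pattern $21\text{-}3\text{-}\cdots\text{-}k$ requires only the first two letters to be adjacent in $\pi$ (for $k=2$ it is $21$). A permutation is $1\text{-}3\text{-}2$-avoiding if it has no occurrence of the classical (fully dashed) pattern $1\text{-}3\text{-}2$. $f_{\tau;r}(n)$ is the number of $1\text{-}3\text{-}2$-avoiding permutations in $S_n$ containing exactly $r$ occurrences of $\tau$ (with $S_0$ consisting of the empty permutation), and $F_\tau(x,y)=\sum_{n,r\ge 0} f_{\tau;r}(n)x^ny^r$, viewed as a formal power series in $x$ with coefficients in $\mathbb Z[y]$. The infinite continued fraction is a formal power series in $x$: writing $B_i=1-\dfrac{x}{xy^{d_i}-1/B_{i+1}}$,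 it is the $x$-adic limit as $m\to\infty$ of the finite fractions $B_1$ obtained by setting $B_m=1$. *)

(* Defs.v *)
From HB Require Import structures.
From mathcomp Require Import all_boot all_order all_fingroup all_algebra.
From mathcomp Require Import boolp.

Set Implicit Arguments.
Unset Strict Implicit.
Unset Printing Implicit Defensive.

Import GRing.Theory.
Local Open Scope ring_scope.

Record fps (R : Type) := Fps { fps_coef : nat -> R }.

HB.instance Definition _ (R : Type) := gen_eqMixin (fps R).
HB.instance Definition _ (R : Type) := gen_choiceMixin (fps R).

Lemma fpsP (R : Type) (f g : fps R) :
  (forall n, fps_coef f n = fps_coef g n) -> f = g.
Proof. by case: f g => [f] [g] /= fg; congr Fps; apply/funext. Qed.

Section FpsZmodule.
Variable R : zmodType.

Definition fps_zero : fps R := Fps (fun=> 0).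
Definition fps_opp (f : fps R) : fps R := Fps (fun n => - fps_coef f n).
Definition fps_add (f g : fps R) : fps R :=
  Fps (fun n => fps_coef f n + fps_coef g n).

Fact fps_addA : associative fps_add.
Proof. by move=> f g h; apply: fpsP => n /=; rewrite addrA. Qed.
Fact fps_addC : commutative fps_add.
Proof. by move=> f g; apply: fpsP => n /=; rewrite addrC. Qed.
Fact fps_add0 : left_id fps_zero fps_add.
Proof. by move=> f; apply: fpsP => n /=; rewrite add0r. Qed.
Fact fps_addN : left_inverse fps_zero fps_opp fps_add.
Proof. by move=> f; apply: fpsP => n /=; rewrite addNr. Qed.

HB.instance Definition _ :=
  GRing.isZmodule.Build (fps R) fps_addA fps_addC fps_add0 fps_addN.

Lemma fps_coef0 n : fps_coef (0 : fps R) n = 0.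
Proof. by []. Qed.
Lemma fps_coefN (f : fps R) n : fps_coef (- f) n = - fps_coef f n.
Proof. by []. Qed.
Lemma fps_coefD (f g : fps R) n :
  fps_coef (f + g) n = fps_coef f n + fps_coef g n.
Proof. by []. Qed.
Lemma fps_coefB (f g : fps R) n :
  fps_coef (f - g) n = fps_coef f n - fps_coef g n.
Proof. by []. Qed.

End FpsZmodule.

Section FpsComRing.
Variable R : comNzRingType.
Implicit Types f g h : fps R.

Definition fpsC (a : R) : fps R := Fps (fun n => if n == 0%N then a else 0).
Definition fpsX : fps R := Fps (fun n => (n == 1%N)%:R).
Definition fps_mul f g : fps R :=
  Fps (fun n => \sum_(i < n.+1) fps_coef f i * fps_coef g (n - i)).

Let trunc (N : nat) f : {poly R} := \poly_(i < N) fps_coef f i.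

Let coef_mulE N f g n : (n < N)%N ->
  fps_coef (fps_mul f g) n = (trunc N f * trunc N g)`_n.
Proof.
move=> nN; rewrite coefM; apply: eq_bigr => i _.
by rewrite !coef_poly (leq_ltn_trans _ nN) ?leq_ord //
   (leq_ltn_trans _ nN) ?leq_subr.
Qed.

Fact fps_mulA : associative fps_mul.
Proof.
move=> f g h; apply: fpsP => n.
have -> : fps_coef (fps_mul f (fps_mul g h)) n =
          (trunc n.+1 f * (trunc n.+1 g * trunc n.+1 h))`_n.
  rewrite coefM; apply: eq_bigr => i _.
  by rewrite (@coef_mulE n.+1) ?ltnS ?leq_subr // /trunc coef_poly ltn_ord.
rewrite mulrA coefM; apply: eq_bigr => i _.
by rewrite (@coef_mulE n.+1) // /trunc [in LHS]coef_poly ltnS leq_subr.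
Qed.

Fact fps_mulC : commutative fps_mul.
Proof.
by move=> f g; apply: fpsP => n; rewrite !(@coef_mulE n.+1) // mulrC.
Qed.

Fact fps_mul1 : left_id (fpsC 1) fps_mul.
Proof.
move=> f; apply: fpsP => n /=.
rewrite big_ord_recl /= mul1r subn0 big1 ?addr0 // => i _.
by rewrite mul0r.
Qed.

Fact fps_mulDl : left_distributive fps_mul (@fps_add R).
Proof.
move=> f g h; apply: fpsP => n /=; rewrite -big_split /=.
by apply: eq_bigr => i _; rewrite mulrDl.
Qed.

Fact fps_one_neq0 : fpsC 1 != 0.
Proof.
apply/eqP => /(congr1 (fun f => fps_coef f 0)) /= /eqP.
by rewrite oner_eq0.
Qed.

HB.instance Definition _ := GRing.Zmodule_isComNzRing.Build (fps R)
  fps_mulA fps_mulC fps_mul1 fps_mulDl fps_one_neq0.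

Lemma fps_coef1 n : fps_coef (1 : fps R) n = (n == 0%N)%:R.
Proof. by case: n. Qed.
Lemma fps_coefM f g n : fps_coef (f * g) n =
  \sum_(i < n.+1) fps_coef f i * fps_coef g (n - i).
Proof. by []. Qed.

End FpsComRing.

Arguments fpsX {R}.

Section FpsUnitRing.
Variable R : comUnitRingType.
Implicit Types f g : fps R.

Definition fps_unit : {pred fps R} :=
  [pred f : fps R | fps_coef f 0 \is a GRing.unit].

(* The first n coefficients of 1 / f, from the equation of each degree of     *)
(* f * (1 / f) = 1.                                                           *)
Fixpoint fps_inv_seq f n : seq R :=
  if n is m.+1 then
    let s := fps_inv_seq f m in
    rcons s ((fps_coef f 0)^-1 *
             ((m == 0%N)%:R - \sum_(j < m) s`_j * fps_coef f (m - j)))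
  else [::].

(* Outside the units the inverse is the identity, as everywhere in MathComp.  *)
Definition fps_inv f : fps R :=
  if f \in fps_unit then Fps (fun n => (fps_inv_seq f n.+1)`_n) else f.

Let size_inv_seq f n : size (fps_inv_seq f n) = n.
Proof. by elim: n => //= n IHn; rewrite size_rcons IHn. Qed.

Let nth_inv_seq f n m : (m < n)%N ->
  (fps_inv_seq f n)`_m = (fps_inv_seq f m.+1)`_m.
Proof.
elim: n => // n IHn; rewrite ltnS leq_eqVlt => /predU1P[-> //|mn].
by rewrite [in LHS]/= nth_rcons size_inv_seq mn IHn.
Qed.

Fact fps_mulVx : {in fps_unit, left_inverse 1 fps_inv *%R}.
Proof.
move=> f fU; apply: fpsP => n; rewrite fps_coefM fps_coef1 /fps_inv fU.
rewrite big_ord_recr /= subnn nth_rcons size_inv_seq ltnn eqxx.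
rewrite mulrAC mulVr // mul1r addrC.
under [X in _ - X]eq_bigr => j _ do rewrite nth_inv_seq //.
exact: subrK.
Qed.

Fact fps_unitPl f g : g * f = 1 -> fps_unit f.
Proof.
move=> /(congr1 (fun h => fps_coef h 0)).
rewrite fps_coefM big_ord1 fps_coef1 => gf1.
by apply/unitrP; exists (fps_coef g 0); split; rewrite // mulrC.
Qed.

Fact fps_invr_out : {in [predC fps_unit], fps_inv =1 id}.
Proof. by move=> f; rewrite inE /fps_inv => /negbTE ->. Qed.

HB.instance Definition _ := GRing.ComNzRing_hasMulInverse.Build (fps R)
  fps_mulVx fps_unitPl fps_invr_out.

Lemma fps_unitE f : (f \is a GRing.unit) = (fps_coef f 0 \is a GRing.unit).
Proof. by []. Qed.

End FpsUnitRing.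

Definition xadic_cvg (R : Type) (u : nat -> fps R) (l : fps R) : Prop :=
  forall N : nat, exists M : nat, forall m : nat, (M <= m)%N ->
    forall n : nat, (n < N)%N -> fps_coef (u m) n = fps_coef l n.

(* [letters] is the one-line notation of the pattern; the j-th boolean of     *)
(* [dashes] tells whether there is a dash between letters j and j + 1.        *)
Record gpattern := GPattern {
  letters : seq nat;
  dashes : seq bool;
  _ : perm_eq letters (iota 1 (size letters));
  _ : size dashes == (size letters).-1
}.

(* A permutation of {1, ..., n} is represented by s : 'S_n, shifting          *)
(* positions and values down by one.                                          *)
Definition is_occurrence (tau : gpattern) (n : nat) (s : 'S_n)
    (i : (size (letters tau)).-tuple 'I_n) : bool :=
  [forall a : 'I_(size (letters tau)), forall b : 'I_(size (letters tau)),
    [&& (a < b)%N ==> (tnth i a < tnth i b)%N,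
        (s (tnth i a) < s (tnth i b))%N ==
          (nth 0%N (letters tau) a < nth 0%N (letters tau) b)%N
      & (b == a.+1 :> nat) && ~~ nth true (dashes tau) a ==>
          (tnth i b == (tnth i a).+1 :> nat)]].

Arguments is_occurrence tau {n} s i.

Definition occ (tau : gpattern) (n : nat) (s : 'S_n) : nat :=
  #|[set i | is_occurrence tau s i]|.

Definition pattern_1_3_2 : gpattern :=
  @GPattern [:: 1; 3; 2]%N [:: true; true] isT isT.

Definition avoids132 (n : nat) (s : 'S_n) : bool := occ pattern_1_3_2 s == 0%N.

Fact letters_21_3_k (k : nat) :
  perm_eq [:: 2, 1 & iota 3 (k - 2)]%N
          (iota 1 (size [:: 2, 1 & iota 3 (k - 2)]%N)).
Proof. by rewrite /= size_iota (perm_catCA [:: 2] [:: 1])%N. Qed.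

Fact dashes_21_3_k (k : nat) :
  size (false :: nseq (k - 2) true) ==
  (size [:: 2, 1 & iota 3 (k - 2)]%N).-1.
Proof. by rewrite /= size_nseq size_iota. Qed.

(* The pattern 21-3-...-k, only meaningful for k >= 2.                        *)
Definition pattern_21_3_k (k : nat) : gpattern :=
  GPattern (letters_21_3_k k) (dashes_21_3_k k).

Definition num_avoid (tau : gpattern) (r n : nat) : nat :=
  #|[set s : 'S_n | avoids132 s && (occ tau s == r)]|.

(* The variable y is 'X : {poly int} and x is fpsX. The bound on r only makes *)
(* the sum finite, see coef_gen_series.                                       *)
Definition gen_series (tau : gpattern) : fps {poly int} :=
  Fps (fun n => \poly_(r < (\max_(s : 'S_n) occ tau s).+1)
                  (num_avoid tau r n)%:Z).

Lemma coef_gen_series (tau : gpattern) (n r : nat) :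
  (fps_coef (gen_series tau) n)`_r = (num_avoid tau r n)%:Z.
Proof.
rewrite coef_poly; case: ifPn => //; rewrite ltnS -ltnNge => rbig.
rewrite /num_avoid (_ : [set _ | _] = set0) ?cards0 //.
apply/setP => s; rewrite !inE; apply/negbTE; rewrite negb_and orbC.
apply/orP; left; apply: contraL rbig => /eqP <-.
by rewrite -leqNgt; apply: (leq_bigmax s).
Qed.

(* B_i truncated so that B_(i + t) = 1.                                       *)
Fixpoint cfrac_tail (d : nat -> nat) (i t : nat) : fps {poly int} :=
  if t is t'.+1 then
    1 - fpsX / (fpsX * fpsC 'X ^+ d i - 1 / cfrac_tail d i.+1 t')
  else 1.

(* B_1 computed from B_m = 1, for m >= 1.                                     *)
Definition cfrac (d : nat -> nat) (m : nat) : fps {poly int} :=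
  cfrac_tail d 1 m.-1.

Lemma cfrac_tail_unit (d : nat -> nat) (i t : nat) :
  cfrac_tail d i t \is a GRing.unit.
Proof.
rewrite fps_unitE; case: t => [|t]; first exact: unitr1.
rewrite [cfrac_tail _ _ _]/(1 - _ / _).
by rewrite fps_coefB fps_coefM big_ord1 mul0r subr0 unitr1.
Qed.

Lemma cfrac_den_unit (d : nat -> nat) (i t : nat) :
  fpsX * fpsC 'X ^+ d i - 1 / cfrac_tail d i.+1 t \is a GRing.unit.
Proof.
rewrite fps_unitE fps_coefB fps_coefM big_ord1 mul0r sub0r unitrN.
by rewrite -fps_unitE mul1r unitrV cfrac_tail_unit.
Qed.

(* Main.v *)
(** Cut a 1-3-2-avoiding permutation at its maximum: w = L n R with every
    letter of L above every letter of R.  Since n separates L from R, an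
    occurrence of 21-3-...-k in w lies in L, or lies in R, or is an occurrence
    of 21-3-...-(k-1) in L followed by n, except that for k = 2 the letter n
    itself makes one descent with R when R is nonempty.  Let e_k count these
    occurrences, and let F_i be the series of the avoiders weighted by y to
    the power sum_l binom(i-1, l) e_(k-l).  By Pascal's rule, passing to L turns
    the weight of index i into that of index i+1, whence
      F_i = 1 + x F_(i+1) (1 - y^(d_i) + y^(d_i) F_i),
    that is, F_i = 1 - x / (x y^(d_i) - 1 / F_(i+1)).  One step of the fraction
    gains one degree of x-adic precision, so the truncations converge to F_1. *)

Require Import Defs.
From mathcomp Require Import all_boot all_order all_fingroup all_algebra.
From mathcomp Require Import zify ring.

Set Implicit Arguments.
Unset Strict Implicit.
Unset Printing Implicit Defensive.

Import Order.TTheory GRing.Theory.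

(** * Occurrences in permutations and in words *)

(* Increasing subsequences of length j, all of whose letters exceed b. *)
Fixpoint inc_count (j b : nat) (w : seq nat) : nat :=
  if j isn't j'.+1 then 1 else
  if w isn't a :: w' then 0 else
  inc_count j b w' + (b < a) * inc_count j' a w'.

(* The occurrences of 21-3-...-(j+2) in a word. *)
Fixpoint drop_inc_count (j : nat) (w : seq nat) : nat :=
  if w is a :: w' then
    (if w' is b :: w'' then (b < a) * inc_count j a w'' else 0)
    + drop_inc_count j w'
  else 0.

Fixpoint av132 (w : seq nat) : bool :=
  if w is a :: w' then pairwise (fun b c => ~~ (a < c < b)) w' && av132 w'
  else true.

(** * Explicit lists of the occurrences in a word *)

Section Listing.
Variables (T : eqType) (f : T -> nat).

(** The subsequences counted by [inc_count], kept as lists. Elements of [T] stand for positions and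
    [f] reads the letter there, so that occurrences can be matched with tuples of positions. *)
Fixpoint inc_list (j b : nat) (w : seq T) : seq (seq T) :=
  if j isn't j'.+1 then [:: [::]] else
  if w isn't a :: w' then [::] else
  inc_list j b w' ++
  (if b < f a then [seq a :: t | t <- inc_list j' (f a) w'] else [::]).

Fixpoint drop_inc_list (j : nat) (w : seq T) : seq (seq T) :=
  if w is a :: w' then
    (if w' is b :: w'' then
       if f b < f a then [seq [:: a, b & t] | t <- inc_list j (f a) w'']
       else [::]
     else [::]) ++ drop_inc_list j w'
  else [::].

Lemma drop_inc_list_cons2 j a b w : drop_inc_list j [:: a, b & w] =
  (if f b < f a then [seq [:: a, b & t] | t <- inc_list j (f a) w] else [::])
  ++ drop_inc_list j (b :: w).
Proof. by []. Qed.

Lemma size_inc_list j b w : size (inc_list j b w) = inc_count j b (map f w).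
Proof.
elim: w j b => [|a w IHw] [|j] b //=.
by rewrite size_cat IHw; case: ifP => _; rewrite ?size_map ?IHw ?mul1n.
Qed.

Lemma size_drop_inc_list j w :
  size (drop_inc_list j w) = drop_inc_count j (map f w).
Proof.
elim: w => //= a [|b w] IHw //=; rewrite size_cat IHw /=.
by case: ifP => _; rewrite ?size_map ?size_inc_list ?mul1n.
Qed.

Lemma mem_inc_list j b w t : (t \in inc_list j b w) =
  [&& size t == j, subseq t w & path ltn b (map f t)].
Proof.
elim: w j b t => [|a w IHw] [|j] b [|c t]; rewrite /= ?inE ?andbF //=.
  rewrite mem_cat IHw /=; case: ifP => // _.
  by apply/negP => /mapP[].
rewrite mem_cat IHw /= eqSS.
have [->|cNa] := eqVneq c a; last first.
  case: ifP => _; rewrite ?orbF // [X in _ || X](_ : _ = false) ?orbF //.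
  by apply/negP => /mapP[t' _ [/eqP]]; rewrite (negPf cNa).
case: ifP => ba; last by rewrite andbF orbF !andbF.
rewrite mem_map => [|t1 t2 [] //]; rewrite IHw.
(* The lists found without the head are absorbed by the second alternative. *)
by apply/orb_idl => /and3P[-> /cons_subseq -> ->].
Qed.

Lemma uniq_inc_list j b w : uniq w -> uniq (inc_list j b w).
Proof.
elim: w j b => [|a w IHw] [|j] b //= /andP[aNw uw].
rewrite cat_uniq IHw //=; case: ifP => //= _.
rewrite map_inj_uniq ?IHw => [|//|t1 t2 [] //].
rewrite andbT; apply/hasPn => _ /mapP[t _ ->]; apply: contra aNw.
rewrite mem_inc_list => /and3P[_ /mem_subseq + _]; apply; exact: mem_head.
Qed.

(* Here p is the position of a letter in the word: consecutive letters of w have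
   consecutive positions, so adjacency in w can be read off p. *)
Lemma mem_drop_inc_list (p : T -> nat) j w t : injective p ->
  sorted (fun x y => p y == (p x).+1) w -> uniq w ->
  (t \in drop_inc_list j w) =
  [&& size t == j.+2, subseq t w &
     if t is [:: x, y & r]
     then [&& p y == (p x).+1, f y < f x & path ltn (f x) (map f r)]
     else false].
Proof.
move=> p_inj; elim: w t => [|a [|b w] IHw] t.
- by case: t => [|x [|y r]]; rewrite ?andbF.
- move=> _ _; case: t => [|x [|y r]]; rewrite /= ?andbF //.
  by case: ifP; rewrite ?andbF.
move=> sw /andP[aNw uw]; have /andP[/eqP pb sw'] := sw.
rewrite drop_inc_list_cons2 mem_cat IHw //.
case: t => [|x [|y r]].
- by rewrite orbF; case: ifP => // _; apply/negP => /mapP[].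
- by rewrite !andbF orbF; case: ifP => // _; apply/negP => /mapP[].
have [->|xNa] := eqVneq x a; last first.
  rewrite [X in X || _](_ : _ = false) //=; first by rewrite (negPf xNa).
  case: ifP => // _; apply/negP => /mapP[r' _ [/eqP]]; by rewrite (negPf xNa).
rewrite [X in _ || X](_ : _ = false) ?orbF; last first.
  apply/and3P => -[_ /mem_subseq /(_ a (mem_head _ _))].
  by rewrite (negPf aNw).
(* As [b] sits just after [a], injectivity of [p] turns adjacency of [a] and [y] into [y = b]. *)
rewrite /= eqxx -pb (inj_eq p_inj) !eqSS.
have [->|yNb] := eqVneq y b; last first.
  rewrite !andbF; case: ifP => // _; apply/negP => /mapP[r' _ [/eqP]].
  by rewrite (negPf yNb).
case: ifP => // ba; rewrite ?andbF //.
by rewrite mem_map ?mem_inc_list // => t1 t2 [].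
Qed.

(** Occurrences using the head contain it, and all others stay inside the tail, where the head does
    not appear. *)
Lemma uniq_drop_inc_list j w : uniq w -> uniq (drop_inc_list j w).
Proof.
have sub v t : t \in drop_inc_list j v -> {subset t <= v}.
  elim: v => // c [|d v] IHv //; rewrite drop_inc_list_cons2 mem_cat.
  case/orP; last first.
    by move=> /IHv tv x /tv xv; rewrite inE xv orbT.
  case: ifP => // _ /mapP[r + ->]; rewrite mem_inc_list.
  case/and3P=> _ /mem_subseq rv _ x; rewrite !inE => /or3P[->|->|/rv ->] //;
    by rewrite !orbT.
elim: w => // a [|b w] IHw // /andP[aNw uw].
rewrite drop_inc_list_cons2 cat_uniq IHw // andbT; apply/andP; split.
  case: ifP => // _; rewrite map_inj_uniq => [|t1 t2 [] //].
  by apply: uniq_inc_list; case/andP: uw.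
apply/hasPn => t /sub tw; case: ifP => // _; apply: contra aNw.
by case/mapP=> r _ tE; apply: tw; rewrite tE mem_head.
Qed.

End Listing.

Lemma card_tuple_set (m : nat) (T : finType) (A : {set m.-tuple T})
    (L : seq (seq T)) :
  uniq L -> {in L, forall t, size t = m} ->
  (forall t : m.-tuple T, (tval t \in L) = (t \in A)) -> #|A| = size L.
Proof.
move=> uL sL LA; rewrite cardE -(size_map val).
apply/perm_size/uniq_perm => //.
  by rewrite map_inj_uniq ?enum_uniq //; apply: val_inj.
move=> t; apply/mapP/idP => [[t' + ->]|tL].
  by rewrite mem_enum -LA.
have/eqP st := sL _ tL.
by exists (Tuple st) => //; rewrite mem_enum -LA.
Qed.

(** Indices become natural numbers with a default value, so that conditions on given letters can be
    read off directly. *)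
Lemma is_occurrenceP (tau : gpattern) (n : nat) (s : 'S_n) (x0 : 'I_n)
    (t : (size (letters tau)).-tuple 'I_n) :
  reflect
    (forall a b, a < size (letters tau) -> b < size (letters tau) ->
      [/\ a < b -> nth x0 t a < nth x0 t b,
          (s (nth x0 t a) < s (nth x0 t b)) =
            (nth 0 (letters tau) a < nth 0 (letters tau) b)
        & b = a.+1 -> ~~ nth true (dashes tau) a ->
            nth x0 t b = (nth x0 t a).+1 :> nat])
    (is_occurrence tau s t).
Proof.
apply: (iffP forallP) => [H a b la lb | H a].
  have /and3P[]:= forallP (H (Ordinal la)) (Ordinal lb).
  rewrite !(tnth_nth x0) /= => /implyP h1 /eqP h2 /implyP h3; split=> //.
  by move=> ba dash; apply/eqP/h3; rewrite ba eqxx.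
apply/forallP => b; have [h1 h2 h3] := H a b (ltn_ord a) (ltn_ord b).
rewrite !(tnth_nth x0) h2 eqxx; apply/and3P; split=> //; first exact/implyP.
by apply/implyP => /andP[/eqP ba dash]; apply/eqP/h3.
Qed.

(** * Permutations as words *)

Definition word (n : nat) (s : 'S_n) : seq nat :=
  [seq val (s i) | i <- enum 'I_n].

Lemma nth_word n (s : 'S_n) (i : 'I_n) : nth 0 (word s) i = s i.
Proof.
by rewrite (nth_map i) ?size_enum_ord ?ltn_ord // nth_ord_enum.
Qed.

Lemma size_word n (s : 'S_n) : size (word s) = n.
Proof. by rewrite size_map size_enum_ord. Qed.

Lemma av132P (w : seq nat) :
  reflect (forall i j k, i < j -> j < k -> k < size w ->
             ~~ (nth 0 w i < nth 0 w k < nth 0 w j)) (av132 w).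
Proof.
elim: w => [|a w IHw] /=; first by left.
apply: (iffP andP) => [[/(pairwiseP 0) aw /IHw {}IHw] [|i] [|j] [|k] //|H].
- move=> /= _ jk kw; rewrite !ltnS in jk kw; apply: aw => //.
  exact: ltn_trans kw.
- exact: (IHw i j k).
split; first by apply/(pairwiseP 0) => j k _ kw jk; apply: (H 0 j.+1 k.+1).
by apply/IHw => i j k ij jk kw; apply: (H i.+1 j.+1 k.+1).
Qed.

Lemma avoids132_word n (s : 'S_n) : avoids132 s = av132 (word s).
Proof.
rewrite /avoids132 cards_eq0; apply/eqP/av132P => [H i j k ij jk|H]; last first.
  apply/setP => t; rewrite [RHS]inE; apply/negP; rewrite inE.
  case/tupleP: t => p t; case/tupleP: t => q t; case/tupleP: t => r t.
  move/(is_occurrenceP s p) => O.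
  have [/(_ isT) pq _ _] := O 0 1 isT isT.
  have [/(_ isT) qr _ _] := O 1 2 isT isT.
  have [_ pr _] := O 0 2 isT isT.
  have [_ rq _] := O 2 1 isT isT.
  have := H p q r pq qr; rewrite size_word ltn_ord !nth_word => /(_ isT).
  by rewrite [s p < s r]pr [s r < s q]rq.
rewrite size_word => kn; have jn := ltn_trans jk kn.
have iN := ltn_trans ij jn; apply/negP => ikj.
pose t := [tuple Ordinal iN; Ordinal jn; Ordinal kn].
suff: t \in [set t | is_occurrence pattern_1_3_2 s t] by rewrite H inE.
move: ikj; rewrite inE (nth_word s (Ordinal iN)) (nth_word s (Ordinal jn)).
rewrite (nth_word s (Ordinal kn)) => /andP[ik kj].
have ij' := ltn_trans ik kj.
apply/(is_occurrenceP s (Ordinal iN)).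
move=> [|[|[|a]]] [|[|[|b]]] //= _ _; split=> //=; rewrite ?ltnn //.
all: try by rewrite ltnNge ltnW.
by move=> _; apply: ltn_trans jk.
Qed.

(** A strictly increasing sequence of positions is the filter of the enumeration by its own
    members. *)
Lemma subseq_enum_ord n (t : seq 'I_n) :
  subseq t (enum 'I_n) = sorted ltn (map val t).
Proof.
have enum_sorted : sorted (relpre val ltn) (enum 'I_n).
  by rewrite -sorted_map val_enum_ord iota_ltn_sorted.
have tr : transitive (relpre (@nat_of_ord n) ltn).
  by move=> y x z; apply: ltn_trans.
rewrite sorted_map; apply/idP/idP => [/subseq_sorted|t_sorted]; first exact.
suff -> : t = [seq x <- enum 'I_n | x \in t] by apply: filter_subseq.
apply: (irr_sorted_eq tr) => //.
- by move=> x /=; rewrite ltnn.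
- exact: sorted_filter.
- by move=> x; rewrite mem_filter mem_enum andbT.
Qed.

(** Swapping its first two letters makes the pattern increasing. Order isomorphism thus says that
    [s] increases along [y], [x], [r]. *)
Lemma is_occurrence_21_3_k j n (s : 'S_n) t x y r :
  tval t = [:: x, y & r] -> size r = j ->
  is_occurrence (pattern_21_3_k j.+2) s t =
  [&& subseq [:: x, y & r] (enum 'I_n), val y == (val x).+1, s y < s x
     & path ltn (s x) [seq val (s i) | i <- r]].
Proof.
(* rk a + 1 is the a-th letter of the pattern. *)
move=> tE sr; pose rk u := if u is u'.+2 then u else 1 - u.
have rkK : involutive rk by case=> [|[|u]].
have rk_lt u : u < j.+2 -> rk u < j.+2 by case: u => [|[|u]].
have sz : size (letters (pattern_21_3_k j.+2)) = j.+2.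
  by rewrite /= size_iota subn2.
have st : size t = j.+2 by rewrite size_tuple sz.
have szlt u : (u < size (letters (pattern_21_3_k j.+2))) = (u < j.+2).
  by rewrite sz.
have letE u : u < j.+2 -> nth 0 (letters (pattern_21_3_k j.+2)) u = (rk u).+1.
  by case: u => [|[|u]] //= uj; rewrite nth_iota ?subn2.
(* Only the first pair lacks a dash; beyond the list the default is a dash too. *)
have dashE u : 0 < u -> nth true (dashes (pattern_21_3_k j.+2)) u.
  by case: u => //= u _; rewrite nth_nseq if_same.
have nthE u : nth x t (rk u) = nth x [:: y, x & r] u.
  by rewrite tE; case: u => [|[|u]].
have nthE' u : nth x t u = nth x [:: y, x & r] (rk u) by rewrite -nthE rkK.
have sizeE : size [:: y, x & r] = j.+2 by rewrite /= sr.
rewrite subseq_enum_ord -tE.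
have -> : (s y < s x) && path ltn (s x) [seq val (s i) | i <- r] =
   sorted ltn [seq val (s i) | i <- [:: y, x & r]] by [].
apply/(is_occurrenceP s x)/and3P.
- move=> O0; have O a b (aj : a < j.+2) (bj : b < j.+2) :=
    O0 a b (etrans (szlt a) aj) (etrans (szlt b) bj).
  split.
  + apply/(sortedP 0) => i; rewrite size_map st => ij.
    have [+ _ _] := O i i.+1 (ltnW ij) ij.
    by rewrite !(nth_map x) ?st ?(ltnW ij) //; apply.
  + by have [_ _] := O 0 1 isT isT; rewrite tE /= => ->.
  + apply/(sortedP 0) => i; rewrite size_map sizeE => ij.
    rewrite !(nth_map x) ?sizeE ?(ltnW ij) // -!nthE.
    have [_ + _] := O _ _ (rk_lt _ (ltnW ij)) (rk_lt _ ij).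
    by rewrite !letE ?rk_lt ?(ltnW ij) // !rkK /= => ->; rewrite ltnSn.
- move=> [t_sorted /eqP xy s_sorted] a b; rewrite !szlt => aj bj; split.
  + move=> ab; have := sorted_ltn_nth ltn_trans 0 t_sorted.
    move=> /(_ a b); rewrite !inE size_map st !(nth_map x) ?st //.
    exact.
  + rewrite !letE // ltnS !nthE'.
    have := @lt_sorted_ltn_nth _ nat 0 _ s_sorted (rk a) (rk b).
    rewrite !inE size_map sizeE !rk_lt // => /(_ isT isT).
    by rewrite !(nth_map x) ?sizeE ?rk_lt //.
  + case: a aj => [|a] aj bE; last by rewrite dashE.
    by rewrite bE tE.
Qed.

Lemma occ_word j n (s : 'S_n) :
  occ (pattern_21_3_k j.+2) s = drop_inc_count j (word s).
Proof.
rewrite /word -(size_drop_inc_list (fun i : 'I_n => s i : nat)).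
have uw := enum_uniq 'I_n.
have sw : sorted (fun x y : 'I_n => y == x.+1 :> nat) (enum 'I_n).
  have <- := @sorted_map _ _ (@nat_of_ord n) (fun a b => b == a.+1).
  rewrite val_enum_ord.
  by case: (n) => //= m; elim: m 0 => //= m IHm a; rewrite eqxx IHm.
have mem t := mem_drop_inc_list (fun i : 'I_n => s i : nat) j t val_inj sw uw.
have sz : size (letters (pattern_21_3_k j.+2)) = j.+2.
  by rewrite /= size_iota subn2.
apply: card_tuple_set.
- exact: uniq_drop_inc_list.
- by move=> t; rewrite mem sz => /andP[/eqP ->].
move=> t; have st : size t = j.+2 by rewrite size_tuple sz.
rewrite mem inE st eqxx andTb.
case tE: (tval t) (st) => [|x [|y r]] // [sr].
by rewrite (is_occurrence_21_3_k s tE sr).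
Qed.

(** * Decomposition at the maximum *)


Lemma inc_count0 b w : inc_count 0 b w = 1.
Proof. by case: w. Qed.

Lemma inc_count_le j b w :
  all (fun c => c <= b) w -> inc_count j b w = (j == 0).
Proof.
case: j => [|j]; first by rewrite inc_count0.
elim: w => //= c w IHw /andP[cb /IHw ->].
by rewrite ltnNge cb.
Qed.

(** Letters of [v] are at most [b], so none is used. The letter [n] is either absent or last, which
    leaves [j + 1] or [j] letters in [u]. *)
Lemma inc_count_split j b n u v :
  b < n -> all (fun a => a < n) u -> all (fun c => c <= b) v ->
  allrel (fun a c => c <= a) u v ->
  inc_count j.+1 b (u ++ n :: v) = inc_count j.+1 b u + inc_count j b u.
Proof.
elim: u j b => [|a u IHu] j b bn /= un vb.
  rewrite bn mul1n !inc_count_le ?add0n //; first by case: j.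
  by apply: sub_all vb => c cb; apply: leq_trans cb (ltnW bn).
case/andP: un => an un; rewrite allrel_consl => /andP[va uv].
rewrite IHu //; case: j => [|j].
  by rewrite !inc_count0 addnAC.
by rewrite IHu // mulnDr addnACA.
Qed.

(** A descent from [n] cannot be prolonged by a letter above [n], so it only matters for the pattern
    21. *)
Lemma drop_inc_count_cons j n v : all (fun c => c < n) v ->
  drop_inc_count j (n :: v) =
  drop_inc_count j v + ((v != [::]) && (j == 0)).
Proof.
case: v => [|c v] //= /andP[cn vn]; rewrite cn mul1n addnC inc_count_le //.
by apply: sub_all vn => d /ltnW.
Qed.

(** Occurrences starting in [u] are handled by [inc_count_split], the junction before [n] is an
    ascent, and those starting at [n] are handled by [drop_inc_count_cons]. *)
Lemma drop_inc_count_split j n u v :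
  all (fun a => a < n) u -> all (fun c => c < n) v ->
  allrel (fun a c => c <= a) u v ->
  drop_inc_count j (u ++ n :: v) =
    drop_inc_count j u + drop_inc_count j v +
    (if j is j'.+1 then drop_inc_count j' u else (v != [::])).
Proof.
move=> + vn; elim: u => [_ _|a [|b u] IHu].
- rewrite drop_inc_count_cons // add0n.
  by case: j => [|j]; rewrite ?andbT ?andbF.
- rewrite all_seq1 /= => an _.
  rewrite [LHS](_ : _ = drop_inc_count j (n :: v)); last first.
    by rewrite /= ltnNge (ltnW an).
  by rewrite drop_inc_count_cons //; case: j {IHu} => [|j];
    rewrite ?andbT ?andbF.
rewrite allrel_consl [all _ _]/= => /andP[an un] /andP[va uv].
have step i x : drop_inc_count i [:: a, b & x] =
    (b < a) * inc_count i a x + drop_inc_count i (b :: x) by [].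
rewrite !cat_cons !step -cat_cons IHu //.
have /andP[_ un'] := un; move: (uv); rewrite allrel_consl => /andP[_ uv'].
case: j {IHu} => [|j]; first by rewrite !inc_count0 !addnA.
by rewrite inc_count_split // mulnDr step; lia.
Qed.

Lemma inc_count_shift m j b w :
  inc_count j (m + b) (map (addn m) w) = inc_count j b w.
Proof.
elim: w j b => [|a w IHw] [|j] b //=.
by rewrite !IHw ltn_add2l.
Qed.

Lemma drop_inc_count_shift m j w :
  drop_inc_count j (map (addn m) w) = drop_inc_count j w.
Proof.
elim: w => //= a [|b w] //= ->.
by rewrite inc_count_shift ltn_add2l.
Qed.

Lemma av132_shift m w : av132 (map (addn m) w) = av132 w.
Proof.
elim: w => //= a w ->; rewrite pairwise_map; congr (_ && _).
by apply: eq_pairwise => b c; rewrite /= !ltn_add2l.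
Qed.

(** With [n] as the letter 3, avoidance forces [v] below [u]; conversely, no occurrence can then
    straddle the two sides. *)
Lemma av132_split n u v :
  all (fun a => a < n) u -> all (fun c => c < n) v ->
  av132 (u ++ n :: v) =
  [&& av132 u, av132 v & allrel (fun a c => c <= a) u v].
Proof.
move=> + vn; elim: u => [_|a u IHu] /=.
  rewrite andbT [X in X && _](_ : _ = true) //.
  apply/(pairwiseP 0) => i j iv jv _.
  by rewrite ltnNge ltnW ?(allP vn) ?mem_nth.
case/andP=> an un; rewrite IHu // allrel_consl pairwise_cat /= allrel_consr.
have -> : all (fun c => ~~ (a < c < n)) v = all (fun c => c <= a) v.
  by apply: eq_in_all => c /(allP vn) /= ->; rewrite andbT -leqNgt.
have -> : all (fun b => ~~ (a < n < b)) u.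
  by apply/allP => b /(allP un) /= /ltnW bn; rewrite [n < b]ltnNge bn andbF.
case va: (all _ v); rewrite /= ?andbF //.
have -> : pairwise (fun b c => ~~ (a < c < b)) v.
  apply/(pairwiseP 0) => i j _ jv _.
  by have /= := allP va _ (mem_nth 0 jv); rewrite leqNgt negb_and => ->.
have -> : allrel (fun b c => ~~ (a < c < b)) u v.
  apply/allrelP => b c _ /(allP va) /=.
  by rewrite leqNgt negb_and => ->.
by rewrite /= andbT andbA.
Qed.

(** * Avoiders as glued pairs of smaller avoiders *)

Definition av_words n := [seq w <- permutations (iota 0 n) | av132 w].

Definition glue (L R : seq nat) : seq nat :=
  [seq size R + a | a <- L] ++ (size L + size R) :: R.

Lemma mem_av_words n w :
  (w \in av_words n) = perm_eq w (iota 0 n) && av132 w.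
Proof. by rewrite mem_filter mem_permutations andbC. Qed.

Lemma size_av_word n w : w \in av_words n -> size w = n.
Proof.
by rewrite mem_av_words => /andP[/perm_size -> _]; rewrite size_iota.
Qed.

Lemma av_word_lt n w : w \in av_words n -> all (fun a => a < n) w.
Proof.
rewrite mem_av_words => /andP[/perm_mem wE _]; apply/allP => a.
by rewrite wE mem_iota.
Qed.

(** The hypotheses of [av132_split] and [drop_inc_count_split] for a glued word. *)
Lemma glue_lt n i L R : i <= n -> L \in av_words i -> R \in av_words (n - i) ->
  [/\ all (fun a => a < n) [seq size R + a | a <- L], all (fun c => c < n) R
    & allrel (fun a c => c <= a) [seq size R + a | a <- L] R].
Proof.
move=> i_n /av_word_lt Li Rn; have := av_word_lt Rn; have := size_av_word Rn.
move=> sR Rlt; split.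
- rewrite all_map; apply: sub_all Li => a ai /=.
  by rewrite sR -{2}(subnK i_n) ltn_add2l.
- by apply: sub_all Rlt => c /leq_trans; apply; rewrite leq_subr.
apply/allrelP => _ c /mapP[a _ ->] /(allP Rlt) cR.
by rewrite sR (leq_trans (ltnW cR)) ?leq_addr.
Qed.

Lemma glue_av_word n i L R : i <= n ->
  L \in av_words i -> R \in av_words (n - i) -> glue L R \in av_words n.+1.
Proof.
move=> i_n Li Rn; have [ltL ltR LR] := glue_lt i_n Li Rn.
have sL := size_av_word Li; have sR := size_av_word Rn.
move: Li Rn; rewrite !mem_av_words => /andP[permL avL] /andP[permR avR].
rewrite /glue sL sR subnKC // in ltL LR *.
rewrite av132_split // av132_shift avL avR LR !andbT.
rewrite -addn1 iotaD add0n cats1 perm_sym perm_rcons -cat1s perm_sym.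
rewrite -cat1s perm_catCA perm_cat2l -{2}(subnK i_n) iotaD perm_catC.
by apply: perm_cat => //; rewrite [0 + _]addnC iotaDl; apply: perm_map.
Qed.

Lemma av_word_glue n w : w \in av_words n.+1 ->
  exists L R, [/\ L \in av_words (size L), R \in av_words (size R),
    size L + size R = n & w = glue L R].
Proof.
rewrite mem_av_words => /andP[wn avw].
have nw : n \in w by rewrite (perm_mem wn) mem_iota ltnSn.
case/splitPr: w / nw wn avw => u v wn avw.
have uvn : perm_eq (v ++ u) (iota 0 n).
  move: wn; rewrite -addn1 iotaD add0n cats1 perm_sym perm_rcons perm_sym.
  by rewrite -(cat1s n v) perm_catCA perm_cons perm_catC.
have lt_n a : a \in v ++ u -> a < n by rewrite (perm_mem uvn) mem_iota.
have un : all (fun a => a < n) u.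
  by apply/allP => a au; rewrite lt_n ?mem_cat ?au ?orbT.
have vn : all (fun a => a < n) v.
  by apply/allP => a av; rewrite lt_n ?mem_cat ?av.
have suv : size v + size u = n by rewrite -size_cat (perm_size uvn) size_iota.
move: avw; rewrite av132_split // => /and3P[avu avv uv].
(* Since [v] lies below [u], sorting both sides separately sorts everything. Hence [v] uses the
   smallest [size v] values and [u] the remaining ones. *)
have /eqP : sort leq v ++ sort leq u = iota 0 n.
  apply: (sorted_eq leq_trans anti_leq); last first.
  - apply: perm_trans uvn; apply: perm_cat; rewrite perm_sort //.
  - exact: iota_sorted.
  rewrite sorted_pairwise ?pairwise_cat -?sorted_pairwise; try exact: leq_trans.
  rewrite !(sort_sorted leq_total) !andbT; apply/allrelP => c a.
  by rewrite !mem_sort => cv au; apply: (allrelP uv).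
rewrite -suv iotaD eqseq_cat ?size_sort ?size_iota // add0n.
case/andP=> /eqP sortv /eqP sortu.
have permv : perm_eq v (iota 0 (size v)) by rewrite -sortv perm_sym perm_sort.
have permu : perm_eq u (iota (size v) (size u)).
  by rewrite -sortu perm_sym perm_sort.
pose L := [seq a - size v | a <- u].
have uE : u = [seq size v + a | a <- L].
  rewrite -map_comp -[LHS]map_id; apply/eq_in_map => a.
  by rewrite (perm_mem permu) mem_iota /= => /andP[/subnKC].
have sL : size L = size u by rewrite size_map.
exists L, v; split; rewrite ?mem_av_words ?permv ?sL //.
- apply/andP; split; last by rewrite -(av132_shift (size v)) -uE.
  apply: (perm_map_inj (@addnI (size v))).
  by rewrite -uE -iotaDl addn0.
- by rewrite addnC.
by rewrite /glue -uE sL addnC.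
Qed.

(** The position of the maximum recovers the size of [L], hence both factors. *)
Lemma glue_inj L R L' R' :
  L \in av_words (size L) -> L' \in av_words (size L') ->
  size L + size R = size L' + size R' -> glue L R = glue L' R' ->
  L = L' /\ R = R'.
Proof.
have index_glue M N : M \in av_words (size M) -> 
    index (size M + size N) (glue M N) = size M.
  move=> /av_word_lt ltM; rewrite index_cat.
  case: ifPn => [/mapP[a /(allP ltM)]|_].
    by move=> + /eqP; rewrite addnC eqn_add2l => /[swap] /eqP <-; rewrite ltnn.
  by rewrite /= eqxx addn0 size_map.
move=> Lm L'm eqs eqg.
have sL : size L = size L' by rewrite -(index_glue L R) // eqg eqs index_glue.
have sR : size R = size R' by apply/eqP; rewrite -(eqn_add2l (size L)) eqs sL.
move/eqP: eqg; rewrite eqseq_cat ?size_map // eqseq_cons sR.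
case/and3P=> /eqP /(inj_map (@addnI _)) -> _ /eqP ->; split=> //.
Qed.

(** The Catalan decomposition as a bijection; [i] is the size of [L]. *)
Lemma perm_av_wordsS n :
  perm_eq (av_words n.+1)
    [seq glue p.1 p.2 | i <- iota 0 n.+1,
       p <- [seq (L, R) | L <- av_words i, R <- av_words (n - i)]].
Proof.
have pairP i p :
    reflect (p.1 \in av_words i /\ p.2 \in av_words (n - i))
      (p \in [seq (L, R) | L <- av_words i, R <- av_words (n - i)]).
  apply: (iffP allpairsP) => [[[L R] [? ? ->]] //|[Li Rn]].
  by exists p; case: p Li Rn.
apply: uniq_perm.
- by rewrite filter_uniq ?permutations_uniq.
- apply: allpairs_uniq_dep => [|i _|]; first exact: iota_uniq.
    apply: allpairs_uniq; rewrite ?filter_uniq ?permutations_uniq //.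
    by move=> [? ?] [? ?].
  move=> x x' /allpairsPdep[i [[L R] [i_n /pairP[Li Ri] ->]]].
  move=> /allpairsPdep[i' [[L' R'] [i'_n /pairP[Li' Ri'] ->]]] /= eqg.
  rewrite mem_iota ltnS /= in i_n; rewrite mem_iota ltnS /= in i'_n.
  rewrite /= in Li Ri Li' Ri'.
  have sLi := size_av_word Li; have sLi' := size_av_word Li'.
  have [] : L = L' /\ R = R'.
    apply: glue_inj eqg; rewrite ?sLi ?sLi' //.
    by rewrite (size_av_word Ri) (size_av_word Ri') !subnKC.
  by move=> LL' ->; rewrite -sLi -sLi' LL'.
move=> w; apply/idP/allpairsPdep => [/av_word_glue[L [R [Lm Rm sLR ->]]]|].
  exists (size L), (L, R); split=> //.
    by rewrite mem_iota ltnS -sLR leq_addr.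
  by apply/pairP; rewrite -sLR addKn.
case=> i [[L R] [+ /pairP[Li Rn] ->]].
by rewrite mem_iota /= add0n ltnS => i_n; apply: glue_av_word Li Rn.
Qed.

(** * Power series and the continued fraction *)


(* The weight of index i = e + 1 for k = j + 2. *)
Definition weight (e j : nat) (w : seq nat) : nat :=
  \sum_(l < j.+1) 'C(e, l) * drop_inc_count (j - l) w.

Lemma weight0 j w : weight 0 j w = drop_inc_count j w.
Proof.
rewrite /weight big_ord_recl bin0 mul1n subn0 big1 ?addn0 //.
Qed.

(** Pascal's rule. In [weight_glue] the extra sum counts the occurrences that the maximum
    completes. *)
Lemma weightS e j w : weight e.+1 j w =
  weight e j w + \sum_(l < j) 'C(e, l) * drop_inc_count (j - l.+1) w.
Proof.
rewrite /weight !big_ord_recl !bin0 -addnA -big_split; congr (_ + _).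
by apply: eq_bigr => l _; rewrite binS mulnDl.
Qed.

Lemma weight_nil e j : weight e j [::] = 0.
Proof. by rewrite /weight big1 // => l _; rewrite muln0. Qed.

Lemma weight_glue e j n i L R : i <= n ->
  L \in av_words i -> R \in av_words (n - i) ->
  weight e j (glue L R) =
  weight e.+1 j L + weight e j R + 'C(e, j) * (R != [::]).
Proof.
move=> i_n Li Ri; have [ltL ltR LR] := glue_lt i_n Li Ri.
have sLR : size L + size R = n.
  by rewrite (size_av_word Li) (size_av_word Ri) subnKC.
have Dsplit l : drop_inc_count l (glue L R) =
    drop_inc_count l L + drop_inc_count l R +
    (if l is l'.+1 then drop_inc_count l' L else R != [::]).
  rewrite /glue sLR drop_inc_count_split // drop_inc_count_shift.
  by case: l => // l; rewrite drop_inc_count_shift.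
rewrite weightS [LHS](eq_bigr _ (fun l _ => congr1 _ (Dsplit _))).
under eq_bigr do rewrite !mulnDr.
(* The term [l = j] belongs to the pattern 21 and gives the contribution of a nonempty [R]; the
   terms [l < j] form the extra sum of [weightS] for [L]. *)
rewrite !big_split /= -/(weight e j L) -/(weight e j R) [in LHS]big_ord_recr /=.
rewrite subnn -!addnA; congr (_ + _); rewrite addnCA; congr (_ + (_ + _)).
by apply: eq_bigr => l _; rewrite -subnSK.
Qed.

(** * Counting permutations through their words *)

Lemma word_inj n : injective (@word n).
Proof.
move=> s t st; apply/permP => i; apply: val_inj.
by rewrite /= -!nth_word st.
Qed.

Lemma perm_word n (s : 'S_n) : perm_eq (word s) (iota 0 n).
Proof.
rewrite -val_enum_ord /word (map_comp val s); apply: perm_map.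
apply: uniq_perm; [|exact: enum_uniq|].
  by rewrite map_inj_uniq ?(enum_uniq 'I_n) //; apply: perm_inj.
move=> i; rewrite mem_enum; apply/mapP; exists (s^-1%g i); rewrite ?mem_enum //.
by rewrite permKV.
Qed.

Lemma word_surj n w : perm_eq w (iota 0 n) -> exists s : 'S_n, w = word s.
Proof.
move=> wn; have sw : size w = n by rewrite (perm_size wn) size_iota.
have uw : uniq w by rewrite (perm_uniq wn) iota_uniq.
(* The default [i] is never taken, as all letters of [w] are below [n]. *)
pose f (i : 'I_n) := insubd i (nth 0 w i).
have fE i : f i = nth 0 w i :> nat.
  rewrite val_insubd ifT // -[_ < n](mem_iota 0) -(perm_mem wn) mem_nth //.
  by rewrite sw.
have f_inj : injective f.
  move=> i k /(congr1 val); rewrite /= !fE => /eqP.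
  by rewrite nth_uniq ?sw // => /eqP /val_inj.
exists (perm f_inj); apply: (@eq_from_nth _ 0) => [|i];
  rewrite sw ?size_word //.
by move=> lt_i; rewrite (nth_word _ (Ordinal lt_i)) permE fE.
Qed.

Lemma num_avoid_count j r n :
  num_avoid (pattern_21_3_k j.+2) r n =
  count (fun w => drop_inc_count j w == r) (av_words n).
Proof.
rewrite /num_avoid cardE -(size_map (@word n)) -size_filter.
apply/perm_size/uniq_perm.
- by rewrite (map_inj_uniq (@word_inj n)) enum_uniq.
- by rewrite !filter_uniq ?permutations_uniq.
move=> w; rewrite mem_filter mem_av_words; apply/mapP/idP => [[s + ->]|].
  by rewrite mem_enum inE avoids132_word occ_word perm_word andbC.
case/and3P=> wr /word_surj[s ws] avw; exists s => //.
by rewrite mem_enum inE avoids132_word occ_word -ws avw.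
Qed.

(** * Power series and one step of the fraction *)

Local Open Scope ring_scope.

Section FpsExtra.
Variable R : comUnitRingType.
Implicit Types f g h c : fps R.

Lemma coef_fpsXM f n :
  fps_coef (fpsX * f) n = if n is m.+1 then fps_coef f m else 0.
Proof.
case: n => [|n]; first by rewrite fps_coefM big_ord1 mul0r.
rewrite fps_coefM big_ord_recl mul0r add0r big_ord_recl mul1r subn1.
by rewrite big1 ?addr0 // => i _; rewrite mul0r.
Qed.

Lemma coef_fpsCM a f n : fps_coef (fpsC a * f) n = a * fps_coef f n.
Proof.
rewrite fps_coefM big_ord_recl subn0 big1 ?addr0 // => i _.
by rewrite mul0r.
Qed.

Lemma fpsC_exp a d : fpsC a ^+ d = fpsC (a ^+ d) :> fps R.
Proof.
elim: d => [|d IHd]; first by [].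
rewrite exprS IHd; apply: fpsP => n; rewrite coef_fpsCM /= exprS.
by case: eqP; rewrite ?mulr0.
Qed.

(** Divisibility by [x^N], which measures x-adic closeness. *)
Definition fps_vanish (N : nat) f := forall n, (n < N)%N -> fps_coef f n = 0.

Lemma fps_vanishMr N f g : fps_vanish N f -> fps_vanish N (f * g).
Proof.
move=> fN n nN; rewrite fps_coefM big1 // => i _.
by rewrite fN ?mul0r // (leq_ltn_trans _ nN) ?leq_ord.
Qed.

Lemma fps_vanishX N f : fps_vanish N f -> fps_vanish N.+1 (fpsX * f).
Proof. by move=> fN [|n] nN; rewrite coef_fpsXM //; apply: fN. Qed.

(** Clearing denominators gives [(b - 1)(x c g - 1) = - x g], a rearrangement of the claim. This is
    the form of the recursion for avoiders. *)
Lemma cfrac_step_eq c g : g \is a GRing.unit ->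
  let b := 1 - fpsX / (fpsX * c - 1 / g) in
  b = 1 + fpsX * g * (1 - c + c * b).
Proof.
move=> gU b; pose u := fpsX * c - 1 / g.
have gK : g * (1 / g) = 1 by rewrite div1r divrr.
have uU : u \is a GRing.unit.
  rewrite fps_unitE fps_coefB coef_fpsXM sub0r unitrN -fps_unitE div1r.
  by rewrite unitrV.
have bu : (b - 1) * u = - fpsX.
  by rewrite /b addrAC subrr add0r mulNr divrK.
have : (b - 1) * (u * g) = - fpsX * g by rewrite mulrA bu.
have -> : u * g = fpsX * c * g - 1 by rewrite -gK /u; ring.
move=> h; apply/eqP; rewrite -subr_eq0; apply/eqP.
have -> : b - (1 + fpsX * g * (1 - c + c * b)) =
  - ((b - 1) * (fpsX * c * g - 1) + fpsX * g) by ring.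
by rewrite h; ring.
Qed.

(** Subtracting the equations gives [(f - f')(1 - x g' c) = x (g - g')(1 - c + c f)], where
    [1 - x g' c] is a unit and [x] brings the extra degree. *)
Lemma cfrac_step_congr N c f g f' g' :
  f = 1 + fpsX * g * (1 - c + c * f) -> f' = 1 + fpsX * g' * (1 - c + c * f') ->
  fps_vanish N (g - g') -> fps_vanish N.+1 (f - f').
Proof.
move=> fE f'E gg'; pose u := 1 - fpsX * g' * c.
have uU : u \is a GRing.unit.
  by rewrite fps_unitE fps_coefB -mulrA coef_fpsXM subr0 unitr1.
have -> : f - f' = fpsX * ((g - g') * ((1 - c + c * f) / u)).
  apply: (mulIr uU).
  have -> : fpsX * ((g - g') * ((1 - c + c * f) / u)) * u =
    fpsX * ((g - g') * ((1 - c + c * f))).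
    by rewrite -!mulrA mulVr // mulr1.
  have -> : (f - f') * u = (f - f') - fpsX * g' * (c * (f - f')).
    by rewrite /u; ring.
  by rewrite {1}fE {1}f'E; ring.
exact/fps_vanishX/fps_vanishMr.
Qed.

End FpsExtra.

(** The series [F_i] for [i = e + 1] and [k = j + 2]. *)
Definition av_series (e j : nat) : fps {poly int} :=
  Fps (fun n => \sum_(w <- av_words n) 'X^(weight e j w)).

Lemma gen_series_av j : gen_series (pattern_21_3_k j.+2) = av_series 0 j.
Proof.
apply: fpsP => n; apply/polyP => r; rewrite coef_gen_series num_avoid_count.
rewrite /= coef_sum -natz -sum1_count natr_sum big_mkcond /=.
apply: eq_bigr => w _; rewrite coefXn weight0 eq_sym.
by case: eqP.
Qed.

Lemma av_series0 e j : fps_coef (av_series e j) 0 = 1.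
Proof. by rewrite /av_series /= big_seq1 weight_nil. Qed.

Lemma av_series_rec e j (c := fpsC 'X ^+ 'C(e, j)) :
  av_series e j =
  1 + fpsX * av_series e.+1 j * (1 - c + c * av_series e j).
Proof.
(* This factor accounts for [R]: a nonempty [R] gains the weight of the descent from the maximum,
   while the empty one keeps coefficient 1. *)
have tailE m : fps_coef (1 - c + c * av_series e j) m =
    \sum_(R <- av_words m) 'X^(weight e j R + 'C(e, j) * (R != [::])).
  rewrite /c fpsC_exp fps_coefD fps_coefB fps_coef1 coef_fpsCM.
  case: m => [|m].
    by rewrite av_series0 /= big_seq1 weight_nil muln0 mulr1 subrK.
  rewrite subr0 add0r /= big_distrr big_seq [RHS]big_seq /=.
  apply: eq_bigr => R /size_av_word; case: R => // a R _.
  by rewrite /= muln1 addnC exprD.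
apply: fpsP => -[|n]; rewrite fps_coefD fps_coef1 -mulrA coef_fpsXM.
  by rewrite av_series0 addr0.
rewrite add0r fps_coefM [LHS](perm_big _ (perm_av_wordsS n)) big_allpairs_dep.
under [RHS]eq_bigr do rewrite tailE.
rewrite -[iota 0 n.+1]val_enum_ord big_map big_enum /=.
apply: eq_bigr => i _; have i_n := leq_ord i.
rewrite big_allpairs big_distrl /= big_seq [RHS]big_seq.
apply: eq_bigr => L Li; rewrite big_distrr /= big_seq [RHS]big_seq.
by apply: eq_bigr => R Ri; rewrite (weight_glue _ _ i_n Li Ri) -addnA exprD.
Qed.

(** Both constant terms are 1, which settles degree 0; each step obeys the recursion of [av_series]
    and gains one degree. The fraction index is [i + 1] because [av_series] is indexed by
    [e = i]. *)
Lemma cfrac_tail_av j i t :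
  fps_vanish t.+1 (cfrac_tail (fun i => 'C(i.-1, j)) i.+1 t - av_series i j).
Proof.
elim: t i => [|t IHt] i.
  by case=> // _; rewrite fps_coefB av_series0 fps_coef1 subrr.
apply: (cfrac_step_congr _ (av_series_rec i j) (IHt i.+1)).
exact/cfrac_step_eq/cfrac_tail_unit.
Qed.

Theorem theorem2p9 (k : nat) (hk : (2 <= k)%N) :
  xadic_cvg (cfrac (fun i : nat => 'C(i.-1, k - 2))) (gen_series (pattern_21_3_k k)).
Proof.
case: k hk => [|[|j]] // _; rewrite subn2 /= gen_series_av => N.
(* For [m >= 1], the [m - 1] steps of the truncation give agreement in all degrees below [m]. *)
exists N => m Nm n nN; apply/eqP; rewrite -subr_eq0 -fps_coefB; apply/eqP.
apply: cfrac_tail_av; lia.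
Qed.
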